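(* There is an absolute constant $C>0$ such that the following holds. Suppose $\mathbf{X}^*$ is an optimal solution to the convex problem $\min_{\mathbf{X}\in\mathcal{F}_{n,k}} f(\mathbf{X})$ satisfying, for some $\delta>0$, the eigen-gap assumption $\lambda_{n-k}(\nabla f(\mathbf{X}^* ))-\lambda_{n-k+1}(\nabla f(\mathbf{X}^* ))\ge\delta$. Let $\{(\mathbf{X}_t,\mathbf{V}_t)\}_{t\ge1}$ be generated by the Frank-Wolfe method with line-search: $\mathbf{X}_1\in\mathcal{F}_{n,k}$ is arbitrary and for all $t\ge1$, $$\mathbf{V}_t\in\arg\min_{\mathbf{V}\in\mathcal{P}_{n,k}}\mathrm{Tr}(\mathbf{V}\nabla f(\mathbf{X}_t)),\qquad \mathbf{X}_{t+1}=(1-\eta_t)\mathbf{X}_t+\eta_t\mathbf{V}_t,$$ with $\eta_t\in[0,1]$ chosen via line-search. Then there exists $T_0=O\big(k(\beta/\delta)^3\big)$, i.e. an integer $T_0\ge1$ with $T_0\le C\max\{1,k(\beta/\delta)^3\}$, such that for all $t\ge T_0$, $$f(\mathbf{X}_{t+1})-f(\mathbf{X}^* )\le\big(f(\mathbf{X}_t)-f(\mathbf{X}^* )\big)\Big(1-\min\Big\{\frac{\delta}{12\beta},\frac12\Big\}\Big).$$ Moreover, for all $t\ge1$, the rank-$k$ matrix $\mathbf{V}_t$ satisfies $$\|\mathbf{V}_t-\mathbf{X}^*\|_F^2\le C\,\frac{\beta^2}{\delta^3}\big(f(\mathbf{X}_t)-f(\mathbf{X}^* )\big).$$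
   Context: Let $1\le k<n$ be integers. $\mathbb{S}^n$ is the space of real symmetric $n\times n$ matrices with inner product $\langle \mathbf{A},\mathbf{B}\rangle=\mathrm{Tr}(\mathbf{A}\mathbf{B})$; $\|\cdot\|_F$ is the Frobenius norm; $\lambda_i(\mathbf{A})$ is the $i$-th largest eigenvalue of $\mathbf{A}\in\mathbb{S}^n$. $\mathcal{P}_{n,k}=\{\mathbf{Q}\mathbf{Q}^\top : \mathbf{Q}\in\mathbb{R}^{n\times k},\ \mathbf{Q}^\top\mathbf{Q}=\mathbf{I}\}$, and the Fantope is $\mathcal{F}_{n,k}=\mathrm{conv}(\mathcal{P}_{n,k})=\{\mathbf{X}\in\mathbb{S}^n : \mathbf{I}\succeq\mathbf{X}\succeq0,\ \mathrm{Tr}(\mathbf{X})=k\}$. $f:\mathbb{S}^n\to\mathbb{R}$ is convex, differentiable and $\beta$-smooth, $\beta>0$: $\|\nabla f(\mathbf{X})-\nabla f(\mathbf{Y})\|_F\le\beta\|\mathbf{X}-\mathbf{Y}\|_F$ for all $\mathbf{X},\mathbf{Y}$. ''Chosen via line-search'' means that $\eta_t$ is chosen by one of the following two options: (first option) $\eta_t\in\arg\min_{\eta\in[0,1]}f((1-\eta)\mathbf{X}_t+\eta\mathbf{V}_t)$; (second option) $\eta_t\in\arg\min_{\eta\in[0,1]}\big\{f(\mathbf{X}_t)+\eta\langle\mathbf{V}_t-\mathbf{X}_t,\nabla f(\mathbf{X}_t)\rangle+\frac{\eta^2\beta}{2}\|\mathbf{V}_t-\mathbf{X}_t\|_F^2\big\}$.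 *)

(* Defs.v *)
From HB Require Import structures.
From mathcomp Require Import all_boot all_order all_algebra.
From mathcomp Require Import all_classical all_reals all_analysis.
From mathcomp Require Import ring.
From mathcomp Require complex spectral sesquilinear.

Set Implicit Arguments.
Unset Strict Implicit.
Unset Printing Implicit Defensive.

Import Order.TTheory GRing.Theory Num.Theory numFieldNormedType.Exports.

Local Open Scope classical_set_scope.
Local Open Scope ring_scope.

Section Frobenius.
Context (R : realType) (n : nat).
Implicit Types A B : 'M[R]_n.

Definition frob_norm A : R := Num.sqrt (\sum_i \sum_j A i j ^+ 2).

Lemma frob_sum_ge0 A : 0 <= \sum_i \sum_j A i j ^+ 2.
Proof. by apply: sumr_ge0 => i _; apply: sumr_ge0 => j _; exact: sqr_ge0. Qed.

Lemma frob_norm_ge0 A : 0 <= frob_norm A.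
Proof. exact: sqrtr_ge0. Qed.

Lemma frob_norm_sqr A : frob_norm A ^+ 2 = \sum_i \sum_j A i j ^+ 2.
Proof. exact/sqr_sqrtr/frob_sum_ge0. Qed.

Lemma frob_normZ (a : R) A : frob_norm (a *: A) = `|a| * frob_norm A.
Proof.
rewrite /frob_norm -sqrtr_sqr -sqrtrM ?sqr_ge0//; congr Num.sqrt.
rewrite mulr_sumr; apply: eq_bigr => i _; rewrite mulr_sumr.
by apply: eq_bigr => j _; rewrite mxE exprMn.
Qed.

Lemma frob_norm_eq0 A : frob_norm A = 0 -> A = 0.
Proof.
move=> A0; have := frob_norm_sqr A; rewrite A0 expr0n/= => /esym/eqP.
rewrite psumr_eq0; last by move=> i _; apply: sumr_ge0 => j _; exact: sqr_ge0.
move=> /allP Ai0; apply/matrixP => i j; rewrite mxE.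
have := Ai0 i (mem_index_enum i); rewrite /= psumr_eq0; last first.
  by move=> ? _; exact: sqr_ge0.
by move=> /allP/(_ j (mem_index_enum j)); rewrite /= sqrf_eq0 => /eqP.
Qed.

Lemma frob_CauchySchwarz A B :
  \sum_i \sum_j A i j * B i j <= frob_norm A * frob_norm B.
Proof.
set s := \sum_i _.
have quad (t : R) : 0 <= frob_norm A ^+ 2 - t * s *+ 2
    + t ^+ 2 * frob_norm B ^+ 2.
  rewrite [X in _ <= X](_ : _ = frob_norm (A - t *: B) ^+ 2) ?sqr_ge0//.
  rewrite !frob_norm_sqr /s 2!mulr_sumr -sumrMnl -sumrB -big_split/=.
  apply: eq_bigr => i _; rewrite 2!mulr_sumr -sumrMnl -sumrB -big_split/=.
  apply: eq_bigr => j _; rewrite !mxE sqrrB; congr (_ - _ *+ _ + _).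
    by rewrite mulrCA.
  by rewrite exprMn.
have [B0|B0] := eqVneq (frob_norm B) 0.
  suff -> : s = 0 by rewrite B0 mulr0.
  rewrite /s big1// => i _; rewrite big1// => j _.
  by rewrite (frob_norm_eq0 B0) mxE mulr0.
have Bgt0 : 0 < frob_norm B by rewrite lt_neqAle eq_sym B0 frob_norm_ge0.
have [s0|s0] := ltP s 0.
  by rewrite (le_trans (ltW s0))// mulr_ge0// frob_norm_ge0.
have := quad (s / frob_norm B ^+ 2).
rewrite [X in _ - X *+ 2 + _](_ : _ = s ^+ 2 / frob_norm B ^+ 2); last first.
  by rewrite mulrAC.
rewrite [X in _ - _ + X](_ : _ = s ^+ 2 / frob_norm B ^+ 2); last first.
  by field.
rewrite mulr2n opprD addrA subrK subr_ge0.
rewrite ler_pdivrMr ?exprn_gt0// -exprMn.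
by rewrite ler_pXn2r// nnegrE// mulr_ge0// frob_norm_ge0.
Qed.

Lemma frob_normD A B : frob_norm (A + B) <= frob_norm A + frob_norm B.
Proof.
have AB : frob_norm (A + B) ^+ 2 = frob_norm A ^+ 2
    + (\sum_i \sum_j A i j * B i j) *+ 2 + frob_norm B ^+ 2.
  rewrite !frob_norm_sqr -sumrMnl -!big_split/=; apply: eq_bigr => i _.
  rewrite -sumrMnl -!big_split/=; apply: eq_bigr => j _.
  by rewrite mxE sqrrD.
rewrite -(@ler_pXn2r _ 2)// ?nnegrE ?addr_ge0 ?frob_norm_ge0//.
by rewrite AB sqrrD lerD2r lerD2l lerMn2r frob_CauchySchwarz.
Qed.

End Frobenius.

(* [Sym R n] is S^n, normed by the Frobenius norm: on [X : Sym R n], [`|X|] is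
   [frob_norm X], whereas the library norm on ['M[R]_n] is the entrywise
   maximum. *)
Section SymmetricMatrices.
Context (R : realType) (n : nat).

Definition symmetric : qualifier 0 'M[R]_n := [qualify A : 'M[R]_n | A^T == A].

Fact symmetric_submod_closed : submod_closed symmetric.
Proof.
split=> [|a A B]; rewrite !qualifE/= ?trmx0// => /eqP At /eqP Bt.
by rewrite linearP/= At Bt.
Qed.

HB.instance Definition _ := GRing.isSubmodClosed.Build R 'M[R]_n
  (has_quality 0 symmetric) symmetric_submod_closed.

Record Sym := MkSym { sym_mx :> 'M[R]_n; _ : sym_mx \is symmetric }.

HB.instance Definition _ := [isSub for sym_mx].
HB.instance Definition _ := [Choice of Sym by <:].
HB.instance Definition _ := [SubChoice_isSubLmodule of Sym by <:].

End SymmetricMatrices.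

Section NormedSymmetricMatrices.
Context (R : realType) (n : nat).
Implicit Types A B : Sym R n.

Fact Sym_normD A B : frob_norm (A + B) <= frob_norm A + frob_norm B.
Proof. exact: frob_normD. Qed.

Fact Sym_normZ (a : R) A : frob_norm (a *: A) = `|a| * frob_norm A.
Proof. exact: frob_normZ. Qed.

Fact Sym_norm_eq0 A : frob_norm A = 0 -> A = 0.
Proof. by move=> /frob_norm_eq0 A0; exact/val_inj. Qed.

HB.instance Definition _ := Lmodule_isNormed.Build R (Sym R n)
  Sym_normD Sym_normZ Sym_norm_eq0.

Lemma Sym_normE A : `|A| = frob_norm A.
Proof. by []. Qed.

Lemma Sym_tr A : A^T = A :> 'M[R]_n.
Proof. by case: A => A /= /eqP. Qed.

End NormedSymmetricMatrices.

Section Gradient.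
Context (R : realType) (n : nat).
Implicit Types (A B : 'M[R]_n) (f : Sym R n -> R).

Definition frob_dot A B : R := \tr (A *m B).

Fact sym_part_subproof A : 2^-1 *: (A + A^T) \is @symmetric R n.
Proof. by rewrite qualifE/= linearZ/= linearD/= trmxK addrC. Qed.

Definition sym_part A : Sym R n := MkSym (sym_part_subproof A).

Fact sym_part_linear : linear sym_part.
Proof.
move=> a A B; apply/val_inj => /=; rewrite linearP/=.
rewrite scalerA mulrC -scalerA -scalerDr; congr (_ *: _).
by rewrite scalerDr addrACA.
Qed.

HB.instance Definition _ :=
  GRing.isLinear.Build R 'M[R]_n (Sym R n) _ sym_part sym_part_linear.

Lemma sym_part_id (H : Sym R n) : sym_part H = H.
Proof.
apply/val_inj; rewrite /= Sym_tr -mulr2n -(scaler_nat 2 (sym_mx H)) scalerA.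
by rewrite mulVf ?scale1r// pnatr_eq0.
Qed.

Lemma frob_dot_norm (H : Sym R n) : frob_dot H H = `|H| ^+ 2.
Proof.
rewrite Sym_normE frob_norm_sqr /frob_dot -{2}Sym_tr.
by apply: eq_bigr => i _; rewrite mxE; apply: eq_bigr => j _; rewrite mxE.
Qed.

Fact grad_subproof f (X : Sym R n) :
  \matrix_(i, j) 'd f X (sym_part (delta_mx i j)) \is @symmetric R n.
Proof.
rewrite qualifE/=; apply/eqP/matrixP => i j; rewrite !mxE.
by congr ('d f X _); apply/val_inj; rewrite /= !trmx_delta addrC.
Qed.

(* Representative of the differential of f at X for the inner product
   [frob_dot] of S^n: see [frob_dot_grad] and [grad_unique]. *)
Definition grad f (X : Sym R n) : Sym R n := MkSym (grad_subproof f X).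

Lemma frob_dot_grad f (X H : Sym R n) : frob_dot H (grad f X) = 'd f X H.
Proof.
rewrite -{2}(sym_part_id H) [in RHS](matrix_sum_delta H) !linear_sum/=.
rewrite /frob_dot /mxtrace; apply: eq_bigr => i _.
rewrite !linear_sum/= mxE; apply: eq_bigr => j _.
rewrite !linearZ/= mxE; congr (_ * 'd f X _); apply/val_inj.
by rewrite /= !trmx_delta addrC.
Qed.

Lemma grad_unique f (X G : Sym R n) :
  (forall H : Sym R n, frob_dot H G = 'd f X H) -> G = grad f X.
Proof.
move=> Gd; apply/eqP; rewrite -subr_eq0; apply/eqP; set D := G - grad f X.
have : frob_dot D D = 0.
  rewrite {2}/D /frob_dot/= mulmxBr linearB/=.
  by rewrite -/(frob_dot D G) -/(frob_dot D (grad f X)) Gd frob_dot_grad subrr.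
rewrite frob_dot_norm => /eqP; rewrite sqrf_eq0 => /eqP D0.
exact: normr0_eq0.
Qed.

End Gradient.

Module SymSpectrum.
Import complex spectral sesquilinear.
Lemma char_poly_conj (F : fieldType) m (P D : 'M[F]_m) : P \in unitmx ->
  char_poly (invmx P *m D *m P) = char_poly D.
Proof.
move=> Pu; rewrite /char_poly/char_poly_mx.
set c := map_mx polyC.
have Pc : c (invmx P) *m c P = 1%:M by rewrite /c -map_mxM mulVmx// map_mx1.
rewrite (_ : _ - _ = c (invmx P) *m ('X%:M - c D) *m c P).
  by rewrite !det_mulmx mulrAC -det_mulmx Pc det1 mul1r.
rewrite mulmxBr mulmxBl mul_mx_scalar -scalemxAl Pc scalemx1.
by rewrite /c !map_mxM.
Qed.

Lemma Sym_char_poly_split (R : realType) n (A : Sym R n) :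
  exists r : 'rV[R]_n, char_poly A = \prod_i ('X - (r 0 i)%:P).
Proof.
pose toC : {rmorphism R -> complex R} := real_complex R.
have Ac_herm : map_mx toC A \is hermitianmx _ false Num.conj.
  rewrite is_hermitianmxE expr0 scale1r; apply/eqP/matrixP => i j.
  rewrite !mxE -{1}(Sym_tr A) mxE.
  by apply/esym/eqP; rewrite -CrealE complex_real.
have /orthomx_spectralP Aspec := hermitian_normalmx Ac_herm.
have dreal := hermitian_spectral_diag_real Ac_herm.
set d := spectral_diag _ in Aspec dreal.
exists (\row_i Re (d 0 i)).
apply: (map_poly_inj toC); rewrite map_char_poly Aspec.
rewrite char_poly_conj ?spectral_unit//.
rewrite char_poly_trig ?diag_mx_is_trig// rmorph_prod; apply: eq_bigr => i _.
rewrite !mxE eqxx mulr1n rmorphB/= map_polyX map_polyC/=; congr ('X - _%:P).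
have /mxOverP/(_ 0 i) := dreal.
by move=> /RRe_real.
Qed.

End SymSpectrum.

Section Eigenvalues.
Context (R : realType) (n : nat).
Implicit Types A : Sym R n.

(* The eigenvalues with multiplicity, in nonincreasing order; [eigenvaluesP]
   and [eigenvalues_unique] show that the choice is not vacuous and
   determined. *)
Definition eigenvalues A : seq R := xget [::]
  [set s | sorted >=%R s /\ char_poly A = \prod_(x <- s) ('X - x%:P)].

Lemma eigenvaluesP A : sorted >=%R (eigenvalues A) /\
  char_poly A = \prod_(x <- eigenvalues A) ('X - x%:P).
Proof.
have [r Ar] := SymSpectrum.Sym_char_poly_split A.
have ex_s : exists s,
    [set s | sorted >=%R s /\ char_poly A = \prod_(x <- s) ('X - x%:P)] s.
  exists (sort >=%R (codom (r 0))); split; first exact/sort_sorted/ge_total.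
  rewrite Ar (perm_big (codom (r 0))) /=; last by rewrite perm_sort.
  by rewrite big_image.
exact: xgetPex ex_s.
Qed.

Lemma eigenvalues_unique A (s : seq R) : sorted >=%R s ->
  char_poly A = \prod_(x <- s) ('X - x%:P) -> s = eigenvalues A.
Proof.
move=> s_sorted As; have [e_sorted Ae] := eigenvaluesP A.
apply: (sorted_eq _ _ s_sorted e_sorted).
- exact: ge_trans.
- exact: ge_anti.
- by apply: prod_XsubC_eq; rewrite -As.
Qed.

(* The i-th largest eigenvalue, for 1 <= i <= n. *)
Definition lambda (i : nat) A : R := (eigenvalues A)`_i.-1.

End Eigenvalues.

Section Optimization.

Definition argmin (R : realType) (T : Type) (D : set T) (g : T -> R) : set T :=
  [set x | D x /\ forall y, D y -> g x <= g y].

Definition conv_hull (R : realType) (E : lmodType R) (D : set E) : set E :=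
  [set x | exists (m : nat) (w : 'I_m -> R) (p : 'I_m -> E),
    [/\ forall i, 0 <= w i, \sum_i w i = 1, forall i, D (p i)
      & x = \sum_i w i *: p i]].

Context (R : realType) (n : nat).

Definition projectors (k : nat) : set (Sym R n) :=
  [set P | exists2 Q : 'M[R]_(n, k),
    Q^T *m Q = 1%:M & P = Q *m Q^T :> 'M[R]_n].

Definition fantope (k : nat) : set (Sym R n) := conv_hull (projectors k).

Lemma mxrank_projector (k : nat) (P : Sym R n) : projectors k P -> \rank P = k.
Proof.
move=> [Q QQ ->]; apply/eqP; rewrite eqn_leq; apply/andP; split.
  exact: leq_trans (mxrankM_maxl _ _) (rank_leq_col _).
have : \rank (Q^T *m (Q *m Q^T) *m Q) = k.
  by rewrite mulmxA QQ mul1mx QQ mxrank1.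
move=> {1}<-.
exact: leq_trans (mxrankM_maxl _ _) (mxrankM_maxr _ _).
Qed.

Definition smooth (beta : R) (f : Sym R n -> R) : Prop :=
  forall X Y, `|grad f X - grad f Y| <= beta * `|X - Y|.

Definition line_search (beta : R) (f : Sym R n -> R) (X V : Sym R n) (eta : R)
    : Prop :=
  argmin `[0, 1] (fun e : R => f ((1 - e) *: X + e *: V)) eta \/
  argmin `[0, 1] (fun e : R => f X + e * frob_dot (V - X) (grad f X)
                     + e ^+ 2 * beta / 2 * `|V - X| ^+ 2) eta.

(* Indices start at 1; the values of X, V and eta at 0 are irrelevant. The
   line-search option may differ from one step to the next. *)
Definition frank_wolfe (k : nat) (beta : R) (f : Sym R n -> R)
    (X V : nat -> Sym R n) (eta : nat -> R) : Prop :=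
  fantope k (X 1%N) /\
  forall t, (1 <= t)%N ->
    [/\ argmin (projectors k) (fun W => frob_dot W (grad f (X t))) (V t),
        line_search beta f (X t) (V t) (eta t)
      & X t.+1 = (1 - eta t) *: X t + eta t *: V t].

End Optimization.

(* Main.v *)
(* Let Xs be the optimal solution and Gs the gradient there. If a symmetric
   matrix G has an eigen-gap delta, its minimizer P over the Fantope is the
   projector on the bottom [k] eigenvectors and
   <X - P, G> >= (delta / 2) |X - P|^2 on the Fantope: in an eigenbasis of G,
   X has its diagonal in [0, 1] and trace k, so that
   <X - P, G> >= delta (k - <X, P>). With G = Gs and P = Xs, convexity turns
   this into quadratic growth, f X - f Xs >= (delta / 2) |X - Xs|^2; together
   with the optimality of V_t it also gives
   |V_t - Xs| <= (2 beta / delta) |X_t - Xs|. The usual O(1/t) rate brings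
   f X_t - f Xs below delta^3 / (18 beta^2), whence
   |X_t - Xs| <= delta / (3 beta), and by Weyl's inequality the gradient at X_t
   still has the gap delta / 3. The growth property with P = V_t then reads
   <X_t - V_t, grad f X_t> >= (delta / 6) |X_t - V_t|^2, which makes the
   quadratic term of the descent lemma comparable to the linear one. *)

Require Import Defs.
From mathcomp Require Import all_boot all_order all_algebra.
From mathcomp Require Import all_classical all_reals all_analysis.
From mathcomp Require Import ring lra zify.

Set Implicit Arguments.
Unset Strict Implicit.
Unset Printing Implicit Defensive.

Import Order.TTheory GRing.Theory Num.Theory numFieldNormedType.Exports.

Local Open Scope classical_set_scope.
Local Open Scope ring_scope.

(** * Spectral theorem for real symmetric matrices *)

Section Spectral.
Context (R : realType).

Lemma rV_sqnormE n (v : 'rV[R]_n) : (v *m v^T) 0 0 = \sum_i v 0 i ^+ 2.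
Proof. by rewrite mxE; apply: eq_bigr => i _; rewrite mxE. Qed.

Lemma rV_sqnorm_ge0 n (v : 'rV[R]_n) : 0 <= (v *m v^T) 0 0.
Proof. by rewrite rV_sqnormE sumr_ge0// => i _; exact: sqr_ge0. Qed.

Lemma rV_sqnorm_gt0 n (v : 'rV[R]_n) : v != 0 -> 0 < (v *m v^T) 0 0.
Proof.
move=> v0; rewrite lt_neqAle rV_sqnorm_ge0 andbT eq_sym.
apply: contra v0; rewrite rV_sqnormE psumr_eq0 => [|i _]; last exact: sqr_ge0.
move=> /allP v0; apply/eqP/rowP => i; rewrite mxE.
by have := v0 i (mem_index_enum i); rewrite /= sqrf_eq0 => /eqP.
Qed.

(* The Householder reflection exchanging the first basis vector and [v]. *)
Lemma householder n (v : 'rV[R]_(1 + n)) : (v *m v^T) 0 0 = 1 ->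
  exists H : 'M[R]_(1 + n), [/\ H^T = H, H *m H = 1%:M & row 0 H = v].
Proof.
move=> v1; pose e : 'rV[R]_(1 + n) := delta_mx 0 0; pose w := v - e.
have ee : e *m e^T = 1%:M.
  rewrite /e trmx_delta mul_delta_mx.
  by apply/matrixP => i j; rewrite !ord1 !mxE.
have vv : v *m v^T = 1%:M by rewrite [LHS]mx11_scalar v1.
have ev : e *m v^T = (v 0 0)%:M.
  by rewrite [LHS]mx11_scalar /e -rowE !mxE.
have ve : v *m e^T = (v 0 0)%:M.
  by rewrite -[LHS]trmxK trmx_mul trmxK ev tr_scalar_mx.
have [w0|w0] := eqVneq w 0.
  exists 1%:M; rewrite trmx1 mulmx1; split=> //.
  by rewrite row1; apply/esym/eqP; rewrite -subr_eq0 -/e -/w w0.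
pose c := (w *m w^T) 0 0.
have c0 : c != 0 by rewrite gt_eqF// rV_sqnorm_gt0.
have ww : w *m w^T = c%:M by exact: mx11_scalar.
(* For unit vectors |v - e|^2 = 2 - 2 <v, e>; this value of [c] is what makes the reflection send
   [e] exactly to [v]. *)
have cE : c = 2 - 2 * v 0 0.
  rewrite /c /w linearB/= mulmxBr !mulmxBl vv ve ev ee !mxE eqxx !mulr1n; ring.
exists (1%:M - (2 / c) *: (w^T *m w)); split.
- by rewrite linearB linearZ/= trmx1 trmx_mul trmxK.
- rewrite mulmxBr mulmx1 mulmxBl mul1mx -scalemxAl -scalemxAr.
  rewrite mulmxA -(mulmxA w^T) ww mul_mx_scalar -scalemxAl !scalerA.
  rewrite mulfVK// -addrA -opprD -scalerBl -scalerDl.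
  rewrite -[RHS]subr0 -(scale0r (w^T *m w)).
  by congr (_ - _ *: _); ring.
- rewrite rowE -/e mulmxBr mulmx1 -scalemxAr mulmxA.
  rewrite (_ : e *m w^T = (v 0 0 - 1)%:M); last first.
    by rewrite /w linearB/= mulmxBr ev ee raddfB.
  rewrite mul_scalar_mx scalerA (_ : 2 / c * _ = -1); last first.
    by rewrite cE in c0 *; field.
  by rewrite scaleN1r opprK addrC subrK.
Qed.

(** Deflation: symmetry carries the zeros of the first row over to the first column, which leaves
    the lower right block for the induction. *)
Lemma row_id_block n (B : 'M[R]_(1 + n)) x : B^T = B ->
  row 0 B = x *: delta_mx 0 0 -> B = block_mx x%:M 0 0 (drsubmx B).
Proof.
move=> Bt B0.
have B0j j : B 0 j = x *+ (j == 0).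
  by move/rowP: B0 => /(_ j); rewrite !mxE eqxx mulr_natr.
have Bj0 j : B j 0 = x *+ (j == 0) by rewrite -Bt mxE B0j.
rewrite -[LHS]submxK; congr block_mx; apply/matrixP => i j; rewrite !mxE !ord1.
- by rewrite !lshift0 B0j eqxx.
- by rewrite lshift0 B0j.
- by rewrite lshift0 Bj0.
Qed.

(** Induction on [n]: a root of the characteristic polynomial has a unit eigenvector, and
    conjugation by the Householder reflection that exchanges it with the first basis vector splits
    off a 1 by 1 block. The roots are split off in the order of [s], so a sorted [s] yields a sorted
    diagonal. *)
Lemma symmetric_spectral n (A : 'M[R]_n) (s : seq R) : A^T = A ->
  char_poly A = \prod_(x <- s) ('X - x%:P) ->
  exists2 U : 'M[R]_n, U *m U^T = 1%:M &
    A = U^T *m diag_mx (\row_i s`_i) *m U.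
Proof.
elim: n A s => [|n IH] A s At As.
  by exists 1%:M; rewrite ?trmx1 ?mulmx1// [LHS]flatmx0 [RHS]flatmx0.
case: s As => [|x s] As.
  by have := size_char_poly A; rewrite As big_nil size_poly1.
have : eigenvalue A x.
  by rewrite eigenvalue_root_char As big_cons rootM root_XsubC eqxx.
move=> /eigenvalueP[u ux u0].
have uu := rV_sqnorm_gt0 u0.
pose v : 'rV[R]_(1 + n) := (Num.sqrt ((u *m u^T) 0 0))^-1 *: u.
have vx : v *m A = x *: v by rewrite -scalemxAl ux !scalerA mulrC.
have v1 : (v *m v^T) 0 0 = 1.
  rewrite /v linearZ/= -scalemxAl -scalemxAr scalerA mxE -expr2 exprVn.
  by rewrite sqr_sqrtr ?ltW// mulVf// gt_eqF.
have [H [Ht HH H0]] := householder v1.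
pose B : 'M[R]_(1 + n) := H *m A *m H.
have Bt : B^T = B by rewrite /B !trmx_mul Ht At mulmxA.
have HB : A = H *m B *m H by rewrite /B !mulmxA HH mul1mx -mulmxA HH mulmx1.
have B0 : row 0 B = x *: delta_mx 0 0.
  rewrite /B -mulmxA row_mul H0 mulmxA vx -scalemxAl -H0 -row_mul HH.
  by rewrite rowE mulmx1.
have Bblock := row_id_block Bt B0.
have Hu : H \in unitmx by case/mulmx1_unit: HH.
have BA : char_poly A = char_poly B.
  have <- := SymSpectrum.char_poly_conj B Hu.
  rewrite (_ : invmx H = H) -?HB//.
  by rewrite -[LHS]mulmx1 -HH mulmxA mulVmx// mul1mx.
clearbody B.
(* The block form factors the characteristic polynomial, and ['X - x%:P] cancels. *)
have Cs : char_poly (drsubmx B) = \prod_(y <- s) ('X - y%:P).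
  have X0 : 'X - x%:P != 0 :> {poly R} by rewrite polyXsubC_eq0.
  apply: (mulfI X0); move: As; rewrite big_cons => <-.
  rewrite BA [in RHS]Bblock.
  rewrite /char_poly /char_poly_mx map_block_mx !map_mx0 (scalar_mx_block _ n).
  by rewrite opp_block_mx add_block_mx !oppr0 !addr0 det_ublock det_mx11 !mxE.
have Ct : (drsubmx B)^T = drsubmx B by rewrite trmx_drsub Bt.
have [W WW CW] := IH (drsubmx B) s Ct Cs.
pose U : 'M[R]_(1 + n) := block_mx 1%:M 0 0 W.
have Ut : U^T = block_mx 1%:M 0 0 W^T by rewrite /U tr_block_mx trmx1 !trmx0.
have UU : U *m U^T = 1%:M.
  rewrite Ut /U mulmx_block !mulmx0 !mul0mx !addr0 add0r WW mulmx1.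
  by rewrite -scalar_mx_block.
have UD D : U^T *m block_mx x%:M 0 0 D *m U = block_mx x%:M 0 0 (W^T *m D *m W).
  rewrite Ut /U !mulmx_block.
  by rewrite !(mulmx0, mul0mx, addr0, add0r, mul1mx, mulmx1).
exists (U *m H); first by rewrite trmx_mul mulmxA -(mulmxA U) Ht HH mulmx1.
rewrite {1}HB trmx_mul Ht !mulmxA; congr (_ *m _).
rewrite -mulmxA -mulmxA; congr (_ *m _); rewrite mulmxA [LHS]Bblock {1}CW.
have -> : diag_mx (\row_i (x :: s)`_i) =
    block_mx x%:M 0 0 (diag_mx (\row_i s`_i)) :> 'M[R]_(1 + n).
  rewrite -[LHS](@submxK _ 1 n 1 n).
  congr block_mx; apply/matrixP => i j; rewrite !mxE ?ord1//.
exact/esym/UD.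
Qed.
End Spectral.

(** * The Fantope *)

Section FrobDot.
Context (R : realType) (n : nat).
Implicit Types A B C : Sym R n.

Lemma frob_dotC A B : frob_dot A B = frob_dot B A.
Proof. exact: mxtrace_mulC. Qed.

Lemma frob_dotDl A B (G : 'M[R]_n) :
  frob_dot (A + B) G = frob_dot A G + frob_dot B G.
Proof. by rewrite /frob_dot/= mulmxDl raddfD. Qed.

Lemma frob_dotZl a A (G : 'M[R]_n) : frob_dot (a *: A) G = a * frob_dot A G.
Proof. by rewrite /frob_dot/= -scalemxAl linearZ. Qed.

Lemma frob_dotBl A B (G : 'M[R]_n) :
  frob_dot (A - B) G = frob_dot A G - frob_dot B G.
Proof. by rewrite /frob_dot/= mulmxBl raddfB. Qed.

Lemma frob_dotBr A B C : frob_dot A (B - C) = frob_dot A B - frob_dot A C.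
Proof. by rewrite 3!(frob_dotC A) frob_dotBl. Qed.

Lemma frob_dot_suml m (w : 'I_m -> R) (p : 'I_m -> Sym R n) (G : 'M[R]_n) :
  frob_dot (\sum_i w i *: p i) G = \sum_i w i * frob_dot (p i) G.
Proof.
pose F A := frob_dot A G.
rewrite -/(F _) (@big_morph _ _ F 0 +%R 0 +%R).
- by apply: eq_bigr => i _; rewrite /F frob_dotZl.
- by move=> A B; rewrite /F frob_dotDl.
- by rewrite /F /frob_dot/= mul0mx mxtrace0.
Qed.

(** Symmetry of [G] turns the trace into the entrywise sum of Cauchy-Schwarz. [G] is a bare matrix
    so that x^T x can be plugged in. *)
Lemma frob_dot_le_norm A (G : 'M[R]_n) : G^T = G ->
  frob_dot A G <= frob_norm A * frob_norm G.
Proof.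
move=> Gt; apply: le_trans (frob_CauchySchwarz A G); rewrite -{1}Gt.
rewrite le_eqVlt; apply/orP; left; apply/eqP; apply: eq_bigr => i _.
by rewrite mxE; apply: eq_bigr => j _; rewrite mxE.
Qed.

Lemma frob_dot_le A B : frob_dot A B <= `|A| * `|B|.
Proof. exact/frob_dot_le_norm/Sym_tr. Qed.

Lemma Sym_sqnormB A B :
  `|A - B| ^+ 2 = `|A| ^+ 2 + `|B| ^+ 2 - 2 * frob_dot A B.
Proof.
rewrite -!frob_dot_norm frob_dotBl !frob_dotBr (frob_dotC B A); ring.
Qed.

End FrobDot.

(** * Convex hulls, and bounds inherited from their generators *)

Section Hull.
Context (R : realType).

(** Concatenate the two families of points, with weights scaled by [1 - a] and [a]. *)
Lemma conv_hull_segment (E : lmodType R) (D : set E) (x y : E) (a : R) :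
  0 <= a <= 1 -> conv_hull D x -> conv_hull D y ->
  conv_hull D ((1 - a) *: x + a *: y).
Proof.
move=> /andP[a0 a1] [m1 [w1 [p1 [w10 w11 Dp1 ->]]]].
move=> [m2 [w2 [p2 [w20 w21 Dp2 ->]]]].
exists (m1 + m2)%N.
exists (fun i => match fintype.split i with
  inl j => (1 - a) * w1 j | inr j => a * w2 j end).
exists (fun i => match fintype.split i with inl j => p1 j | inr j => p2 j end).
have sl j : fintype.split (lshift m2 j) = inl j :> 'I_m1 + 'I_m2.
  exact: (unsplitK (inl j)).
have sr j : fintype.split (rshift m1 j) = inr j :> 'I_m1 + 'I_m2.
  exact: (unsplitK (inr j)).
split.
- by move=> i; case: fintype.split => j; rewrite mulr_ge0// subr_ge0.
- rewrite big_split_ord/=.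
  under eq_bigr do rewrite sl. under [X in _ + X]eq_bigr do rewrite sr.
  by rewrite -!mulr_sumr w11 w21 !mulr1 subrK.
- by move=> i; case: fintype.split.
- rewrite big_split_ord/=.
  under [X in _ = X + _]eq_bigr do rewrite sl -scalerA.
  under [X in _ = _ + X]eq_bigr do rewrite sr -scalerA.
  by rewrite -!scaler_sumr.
Qed.

Lemma sub_conv_hull (E : lmodType R) (D : set E) : D `<=` conv_hull D.
Proof.
move=> x Dx; exists 1%N, (fun=> 1), (fun=> x).
by rewrite !big_ord1 scale1r; split.
Qed.

(** A linear functional averages its values at the generators, so claims about the Fantope reduce to
    projectors. *)
Lemma conv_hull_dot_ge n (D : set (Sym R n)) (G : 'M[R]_n) c X :
  (forall P, D P -> c <= frob_dot P G) -> conv_hull D X -> c <= frob_dot X G.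
Proof.
move=> Dc [m [w [p [w0 w1 Dp ->]]]]; rewrite frob_dot_suml.
rewrite -[c]mul1r -w1 mulr_suml; apply: ler_sum => i _.
by rewrite ler_wpM2l// Dc.
Qed.

Lemma conv_hull_dot_le n (D : set (Sym R n)) (G : 'M[R]_n) c X :
  (forall P, D P -> frob_dot P G <= c) -> conv_hull D X -> frob_dot X G <= c.
Proof.
move=> Dc [m [w [p [w0 w1 Dp ->]]]]; rewrite frob_dot_suml.
rewrite -[c]mul1r -w1 mulr_suml; apply: ler_sum => i _.
by rewrite ler_wpM2l// Dc.
Qed.

Lemma conv_hull_norm_le (E : normedModType R) (D : set E) c X :
  (forall P, D P -> `|P| <= c) -> conv_hull D X -> `|X| <= c.
Proof.
move=> Dc [m [w [p [w0 w1 Dp ->]]]].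
rewrite (le_trans (ler_norm_sum _ _ _))// -[c]mul1r -w1 mulr_suml.
by apply: ler_sum => i _; rewrite normrZ ger0_norm// ler_wpM2l// Dc.
Qed.

End Hull.

(** * Norm, trace and quadratic form on the Fantope *)

Section Fantope.
Context (R : realType) (n k : nat).
Implicit Types X P : Sym R n.

Lemma projectors_fantope P : projectors k P -> fantope k P.
Proof. exact: sub_conv_hull. Qed.

Lemma projector_sqnorm P : projectors k P -> `|P| ^+ 2 = k%:R.
Proof.
move=> [Q QQ PQ]; rewrite -frob_dot_norm /frob_dot PQ.
by rewrite mulmxA mxtrace_mulC !mulmxA QQ mul1mx QQ mxtrace1.
Qed.

Lemma fantope_norm X : fantope k X -> `|X| <= Num.sqrt k%:R.
Proof.
apply: conv_hull_norm_le => P /projector_sqnorm <-.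
by rewrite sqrtr_sqr normr_id.
Qed.

Lemma fantope_sqnorm X : fantope k X -> `|X| ^+ 2 <= k%:R.
Proof.
move=> /fantope_norm kX; rewrite -[leRHS](@sqr_sqrtr _ k%:R)//.
by rewrite ler_pXn2r// nnegrE// sqrtr_ge0.
Qed.

Lemma fantope_sqdiam X P : fantope k X -> fantope k P ->
  `|X - P| ^+ 2 <= 4 * k%:R.
Proof.
move=> /fantope_norm kX /fantope_norm kP.
rewrite -[k%:R](@sqr_sqrtr _ k%:R)// (_ : 4 = 2 ^+ 2)//; last by ring.
rewrite -exprMn ler_pXn2r ?nnegrE ?mulr_ge0 ?sqrtr_ge0//.
rewrite (le_trans (ler_normB _ _))//; lra.
Qed.

Lemma fantope_trace X : fantope k X -> \tr X = k%:R.
Proof.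
have trP P : projectors k P -> frob_dot P 1%:M = k%:R.
  move=> [Q QQ PQ]; rewrite /frob_dot mulmx1 PQ mxtrace_mulC QQ.
  by rewrite mxtrace1.
move=> Xk; apply/eqP; rewrite eq_le -[sym_mx X]mulmx1 -/(frob_dot X 1%:M).
apply/andP; split; first by apply: conv_hull_dot_le Xk => P /trP->.
by apply: conv_hull_dot_ge Xk => P /trP->.
Qed.

(** The quadratic form at [u] is linear in [X], namely the pairing with u^T u, so projectors
    suffice. This is the half 0 <= X <= I of the spectral description of the Fantope. *)
Lemma fantope_quad X (u : 'rV[R]_n) : fantope k X -> (u *m u^T) 0 0 = 1 ->
  0 <= (u *m X *m u^T) 0 0 <= 1.
Proof.
move=> Xk u1.
have dotE (Y : Sym R n) : (u *m Y *m u^T) 0 0 = frob_dot Y (u^T *m u).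
  by rewrite /frob_dot mulmxA mxtrace_mulC mulmxA /mxtrace big_ord1.
rewrite dotE; apply/andP; split.
  apply: conv_hull_dot_ge Xk => P [Q QQ PQ].
  by rewrite -dotE PQ mulmxA -mulmxA -trmx_mul rV_sqnorm_ge0.
apply: conv_hull_dot_le Xk => P [Q QQ PQ]; rewrite -dotE.
(* [u P u^T = |u P|^2] and [0 <= |u - u P|^2 = 1 - u P u^T] as [P ^ 2 = P] *)
have PP : P *m P = P by rewrite PQ mulmxA -(mulmxA Q) QQ mulmx1.
have := rV_sqnorm_ge0 (u - u *m P).
rewrite linearB/= mulmxBr !mulmxBl trmx_mul Sym_tr !mulmxA.
rewrite -(mulmxA u P P) PP subrr subr0.
by rewrite mxE u1 mxE subr_ge0.
Qed.

End Fantope.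

(** * Eigen-gaps *)

Section EigenGap.
Context (R : realType) (n : nat).
Implicit Types A B G X P : Sym R n.

Lemma size_eigenvalues A : size (eigenvalues A) = n.
Proof.
have [_ Ae] := eigenvaluesP A.
by apply: succn_inj; rewrite -(size_char_poly A) Ae size_prod_XsubC.
Qed.

Lemma lambda_le A i j : (1 <= i <= j)%N -> (j <= n)%N ->
  lambda j A <= lambda i A.
Proof.
move=> /andP[i1 ij] jn; have [es _] := eigenvaluesP A.
apply: (sorted_leq_nth (@ge_trans _ _) (@ge_refl _ _) 0 es).
- by rewrite inE size_eigenvalues; lia.
- by rewrite inE size_eigenvalues; lia.
- by lia.
Qed.

Lemma Sym_spectral A : exists2 U : 'M[R]_n, U *m U^T = 1%:M &
  A = U^T *m diag_mx (\row_i lambda i.+1 A) *m U :> 'M[R]_n.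
Proof.
have [_ Ae] := eigenvaluesP A; exact: symmetric_spectral (Sym_tr A) Ae.
Qed.

Lemma diag_quad (U : 'M[R]_n) (d : 'rV[R]_n) (x : 'rV[R]_n) :
  (x *m (U^T *m diag_mx d *m U) *m x^T) 0 0
  = \sum_i d 0 i * (x *m U^T) 0 i ^+ 2.
Proof.
rewrite !mulmxA -mulmxA -{2}[U]trmxK -trmx_mul.
move: (x *m U^T) => y; rewrite mxE; apply: eq_bigr => i _.
by rewrite mul_mx_diag !mxE; ring.
Qed.

Lemma row_quad_isometry (U : 'M[R]_n) (x : 'rV[R]_n) : U *m U^T = 1%:M ->
  \sum_i (x *m U^T) 0 i ^+ 2 = (x *m x^T) 0 0.
Proof.
move=> /mulmx1C UU; rewrite -rV_sqnormE trmx_mul trmxK.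
by rewrite -mulmxA (mulmxA _ U) UU mul1mx.
Qed.

Lemma frob_norm_rank1 (x : 'rV[R]_n) :
  frob_norm (x^T *m x) = (x *m x^T) 0 0.
Proof.
apply/eqP; rewrite -(@eqrXn2 _ 2)// ?frob_norm_ge0 ?rV_sqnorm_ge0//.
rewrite frob_norm_sqr rV_sqnormE expr2 mulr_suml; apply/eqP.
apply: eq_bigr => i _; rewrite mulr_sumr; apply: eq_bigr => j _.
by rewrite mxE big_ord1 !mxE exprMn.
Qed.

(* The [i]-dimensional span of the top eigenvectors of [A] meets the
   [(n - i + 1)]-dimensional span of the bottom eigenvectors of [B]: the
   [n - 1] conditions are the nonzero columns of the matrix [M] below. *)
Lemma weyl_lambda A B i : (1 <= i <= n)%N ->
  lambda i A - lambda i B <= `|A - B|.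
Proof.
move=> i1n; have [U UU AE] := Sym_spectral A; have [W WW BE] := Sym_spectral B.
pose M : 'M[R]_n := \matrix_(a, b) (if (b < i.-1)%N then W^T a b
  else if (i.-1 < b)%N then U^T a b else 0).
have ltin : (i.-1 < n)%N by lia.
have : \det M = 0.
  rewrite -det_tr (expand_det_row _ (Ordinal ltin)) big1// => j _.
  by rewrite !mxE/= ltnn mul0r.
move=> /eqP/det0P[x x0 xM].
have xU (b : 'I_n) : (i.-1 < b)%N -> (x *m U^T) 0 b = 0.
  move=> ib; have /rowP/(_ b) := xM; rewrite !mxE => {2}<-.
  by apply: eq_bigr => a _; rewrite [M _ _]mxE ib ltnNge (ltnW ib).
have xW (b : 'I_n) : (b < i.-1)%N -> (x *m W^T) 0 b = 0.
  move=> ib; have /rowP/(_ b) := xM; rewrite !mxE => {2}<-.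
  by apply: eq_bigr => a _; rewrite [M _ _]mxE ib.
have xx := rV_sqnorm_gt0 x0; set c := (x *m x^T) 0 0 in xx.
have Ax : lambda i A * c <= (x *m A *m x^T) 0 0.
  rewrite AE diag_quad /c -(row_quad_isometry x UU) mulr_sumr.
  apply: ler_sum => b _; rewrite mxE.
  have [ib|bi] := ltnP i.-1 b; first by rewrite xU// expr0n !mulr0.
  by rewrite ler_wpM2r ?sqr_ge0// lambda_le; lia.
have Bx : (x *m B *m x^T) 0 0 <= lambda i B * c.
  rewrite BE diag_quad /c -(row_quad_isometry x WW) mulr_sumr.
  apply: ler_sum => b _; rewrite mxE.
  have [bi|ib] := ltnP b i.-1; first by rewrite xW// expr0n !mulr0.
  rewrite ler_wpM2r ?sqr_ge0// lambda_le//; lia.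
(* The two bounds squeeze the eigenvalue difference times |x|^2 below x (A - B) x^T, the pairing of
   [A - B] with x^T x, whose Frobenius norm is |x|^2. *)
rewrite -(ler_pM2r xx).
have : frob_dot (A - B) (x^T *m x) <= `|A - B| * c.
  rewrite /c -frob_norm_rank1 frob_dot_le_norm//.
  by rewrite trmx_mul trmxK.
apply: le_trans; rewrite frob_dotBl.
have dotE (Y : Sym R n) : frob_dot Y (x^T *m x) = (x *m Y *m x^T) 0 0.
  by rewrite /frob_dot mulmxA mxtrace_mulC mulmxA /mxtrace big_ord1.
rewrite !dotE; lra.
Qed.

(** Weyl's inequality is used once for each eigenvalue, in opposite directions; hence the factor
    2. *)
Lemma eigengap_perturb A B i j : (1 <= i <= n)%N -> (1 <= j <= n)%N ->
  lambda i A - lambda j A - 2 * `|A - B| <= lambda i B - lambda j B.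
Proof.
move=> /(weyl_lambda A B) iAB /(weyl_lambda B A); rewrite (distrC B A) => jBA.
by have := lerD iAB jBA; lra.
Qed.

Lemma frob_dot_diag X (U : 'M[R]_n) (d : 'rV[R]_n) :
  frob_dot X (U^T *m diag_mx d *m U) = \sum_i d 0 i * (U *m X *m U^T) i i.
Proof.
rewrite /frob_dot !mulmxA mxtrace_mulC !mulmxA.
by apply: eq_bigr => i _; rewrite mul_mx_diag mxE mulrC.
Qed.

(** The diagonal entries are the quadratic form of [X] at the rows of [U], which are unit
    vectors. *)
Lemma fantope_orthogonal_diag k X (U : 'M[R]_n) i : U *m U^T = 1%:M ->
  fantope k X -> 0 <= (U *m X *m U^T) i i <= 1.
Proof.
move=> UU Xk.
have rowE (Y : 'M[R]_n) :
    (row i U *m Y *m (row i U)^T) 0 0 = (U *m Y *m U^T) i i.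
  by rewrite -row_mul !mxE; apply: eq_bigr => j _; rewrite !mxE.
rewrite -rowE; apply: fantope_quad Xk _.
by rewrite -[row i U]mulmx1 trmx_mul trmx1 mul1mx rowE mulmx1 UU mxE eqxx.
Qed.

Lemma fantope_orthogonal_trace k X (U : 'M[R]_n) : U *m U^T = 1%:M ->
  fantope k X -> \sum_i (U *m X *m U^T) i i = k%:R.
Proof.
move=> UU Xk; rewrite -/(\tr _) mxtrace_mulC mulmxA (mulmx1C UU) mul1mx.
exact: fantope_trace Xk.
Qed.

End EigenGap.

(** In the eigenbasis of [G], k - <X, P> is the diagonal mass of [X] on the top [n - k]
    eigenvectors. The trace forces the same mass to be missing at the bottom, and moving each unit
    of it up costs at least the gap. *)
Lemma eigengap_projector (R : realType) (n k : nat) (G : Sym R n) (delta : R) :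
  (1 <= k < n)%N -> 0 <= delta ->
  delta <= lambda (n - k) G - lambda (n - k + 1) G ->
  exists2 P, projectors k P & forall X, fantope k X ->
    delta / 2 * `|X - P| ^+ 2 <= frob_dot (X - P) G.
Proof.
move=> k1n d0 gap.
(* Writing [n] as [m + k] gives block matrices: [m] top eigenvectors, then the [k] bottom ones,
   whose rows of [U] make up [Q]. *)
have [m nE] : exists m, n = (m + k)%N by exists (n - k)%N; lia.
subst n; rewrite addnK addn1 in gap.
have [U UU GE] := Sym_spectral G; set d := \row_i _ in GE.
pose Q : 'M[R]_(m + k, k) := (dsubmx U)^T.
have Pt : Q *m Q^T \is @Defs.symmetric R (m + k).
  by rewrite qualifE/= trmx_mul trmxK.
have UQ : U *m Q = col_mx 0 1%:M.
  rewrite -[U in U *m _]vsubmxK mul_col_mx /Q.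
  have := UU; rewrite -[U]vsubmxK tr_col_mx mul_col_row vsubmxK.
  by rewrite (scalar_mx_block m k) => /eq_block_mx[_ -> _ ->].
have QQ : Q^T *m Q = 1%:M.
  have -> : Q = U^T *m (U *m Q) by rewrite mulmxA (mulmx1C UU) mul1mx.
  rewrite trmx_mul trmxK mulmxA -(mulmxA _ U) UU mulmx1 UQ.
  by rewrite tr_col_mx trmx0 trmx1 mul_row_col mul0mx mulmx1 add0r.
pose P := MkSym Pt; have kP : projectors k P by exists Q.
have UPU : U *m P *m U^T = block_mx 0 0 0 1%:M.
  rewrite /P/= mulmxA -mulmxA -trmx_mul UQ tr_col_mx mul_col_row.
  by rewrite trmx0 trmx1 !mul0mx mulmx0 mulmx1.
exists P => // X kX; pose y i := (U *m X *m U^T) i i.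
have y01 i : 0 <= y i <= 1 by exact: fantope_orthogonal_diag UU kX.
have ysum : \sum_i y i = k%:R by exact: fantope_orthogonal_trace UU kX.
have XP : frob_dot X P = \sum_(j < k) y (rshift m j).
  rewrite /frob_dot /P/= mulmxA mxtrace_mulC mulmxA.
  rewrite /mxtrace; apply: eq_bigr => j _.
  rewrite /y /Q trmxK -[U in RHS]vsubmxK.
  by rewrite mul_col_mx tr_col_mx mul_col_row block_mxEdr.
(* Expand the square with |X|^2 <= k and |P|^2 = k. *)
have norm_le : `|X - P| ^+ 2 <= 2 * (k%:R - frob_dot X P).
  rewrite Sym_sqnormB (projector_sqnorm kP).
  by have := fantope_sqnorm kX; lra.
apply: (@le_trans _ _ (delta * (k%:R - frob_dot X P))).
  rewrite [leRHS](_ : _ = delta / 2 * (2 * (k%:R - frob_dot X P)));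
    last by field.
  by rewrite ler_wpM2l// divr_ge0.
rewrite frob_dotBl GE !frob_dot_diag UPU !big_split_ord/=.
(* [d] is indexed from 0 and [lambda] from 1: the top block ends with [lambda m], the bottom one
   starts with [lambda m.+1]. *)
have ul (j : 'I_m) : lambda m G <= d 0 (lshift k j).
  by rewrite mxE/= lambda_le//; have := ltn_ord j; lia.
have dr (j : 'I_k) : d 0 (rshift m j) <= lambda m.+1 G.
  by rewrite mxE/= lambda_le//; have := ltn_ord j; lia.
rewrite [X in _ - (X + _)]big1 ?add0r; last first.
  by move=> j _; rewrite block_mxEul [X in _ * X]mxE mulr0.
under [X in _ - X]eq_bigr do rewrite block_mxEdr [X in _ * X]mxE eqxx mulr1.
rewrite -addrA -sumrB XP.
have -> : k%:R - \sum_j y (rshift m j) = \sum_j y (lshift k j).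
  by rewrite -ysum big_split_ord/= addrK.
have Hl : lambda m G * (\sum_j y (lshift k j)) <=
    \sum_j d 0 (lshift k j) * y (lshift k j).
  rewrite mulr_sumr; apply: ler_sum => j _.
  by rewrite ler_wpM2r//; case/andP: (y01 (lshift k j)).
have Hr : - (lambda m.+1 G * (\sum_j y (lshift k j))) <=
    \sum_j (d 0 (rshift m j) * y (rshift m j) - d 0 (rshift m j)).
  have -> : \sum_j y (lshift k j) = \sum_(j < k) (1 - y (rshift m j)).
    rewrite sumrB sumr_const card_ord -ysum big_split_ord/=; ring.
  rewrite mulr_sumr -sumrN; apply: ler_sum => j _.
  have := dr j; case/andP: (y01 (rshift m j)) => _; nra.
have Hy : 0 <= \sum_j y (lshift k j).
  by apply: sumr_ge0 => j _; case/andP: (y01 (lshift k j)).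
nra.
Qed.

(** The growth property at [P] itself, with the optimality of [P], forces [P] to be the spectral
    projector. [P] is only assumed in the Fantope, so that both the optimal solution and the
    Frank-Wolfe vertices qualify. *)
Lemma eigengap_growth (R : realType) (n k : nat) (G P X : Sym R n) (delta : R) :
  (1 <= k < n)%N -> 0 < delta ->
  delta <= lambda (n - k) G - lambda (n - k + 1) G ->
  fantope k P ->
  (forall W, projectors k W -> frob_dot P G <= frob_dot W G) ->
  fantope k X -> delta / 2 * `|X - P| ^+ 2 <= frob_dot (X - P) G.
Proof.
move=> k1n d0 gap kP Pmin.
have [P0 kP0 growth] := eigengap_projector k1n (ltW d0) gap.
suff -> : P = P0 by exact: growth.
have := growth P kP; rewrite frob_dotBl => PP0.
have : delta / 2 * `|P - P0| ^+ 2 <= 0.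
  by rewrite (le_trans PP0)// subr_le0 Pmin.
rewrite pmulr_rle0 ?divr_gt0// => PP.
apply/eqP; rewrite -subr_eq0 -normr_eq0 -sqrf_eq0 eq_le PP; exact: sqr_ge0.
Qed.

(** * Smooth convex functions *)

Section Smooth.
Context (R : realType) (n : nat) (f : Sym R n -> R) (beta : R).
Context (df : forall Y, differentiable f Y).
Implicit Types X Y Z D : Sym R n.

Lemma is_derive_line Y D (s : R) :
  is_derive s 1 (fun t : R => f (Y + t *: D))
    (frob_dot D (grad f (Y + s *: D))).
Proof.
have dl : is_diff s ((cst Y : R -> Sym R n) + ( *:%R^~ D)) (0 + ( *:%R^~ D)).
  by apply: is_diffD.
have dfl : differentiable (f \o ((cst Y : R -> Sym R n) + ( *:%R^~ D))) s.
  by apply: differentiable_comp; [exact: ex_diff | exact: df].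
apply: DeriveDef; first exact: diff_derivable.
rewrite deriveE//.
rewrite diff_comp; [|exact: ex_diff|exact: df].
rewrite [LHS]/= (@diff_val _ _ _ _ _ _ _ dl).
by rewrite frob_dot_grad; congr ('d f _ _); rewrite [LHS]add0r scale1r.
Qed.

Context (fsmooth : smooth beta f).

(** The sign [e] treats the upper and the lower bound at once. The Lipschitz gradient makes the
    derivative of [g] nonpositive on [0, 1], so one mean value point replaces the usual integral. *)
Lemma smooth_remainder (e : R) Y D : `|e| <= 1 ->
  e * (f (Y + D) - f Y - frob_dot D (grad f Y)) <= beta / 2 * `|D| ^+ 2.
Proof.
move=> e1; set a := frob_dot D (grad f Y); set b := beta / 2 * `|D| ^+ 2.
pose w (t : R) := frob_dot D (grad f (Y + t *: D)).
(* [g 1 - g 0] is the left side minus the right side of the claim. *)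
pose g (t : R) := e * (f (Y + t *: D) - t * a) - t ^+ 2 * b.
pose dg (t : R) := e * (w t - a) - 2 * t * b.
have gdg (t : R) : is_derive t 1 g (dg t).
  have fl : is_derive t 1 (fun u : R => f (Y + u *: D)) (w t).
    exact: is_derive_line.
  move: a b @g @dg => a b g dg.
  have h1 : is_derive t 1 (fun u : R => u * a) a.
    apply: (is_derive_eq (is_deriveM (is_derive_id t 1) (is_derive_cst a t 1))).
    by rewrite scaler0 add0r [LHS]mulr1.
  have h2 : is_derive t 1 (fun u : R => u ^+ 2 * b) (2 * t * b).
    apply: (is_derive_eq (is_deriveM (is_deriveX 2 (is_derive_id t 1))
      (is_derive_cst b t 1))).
    rewrite scaler0 add0r /GRing.scale/=; ring.
  exact: (is_deriveB (is_deriveZ e (is_deriveB fl h1)) h2).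
have gcont : {within `[0, 1], continuous g}.
  apply: continuous_subspaceT => x; apply/differentiable_continuous.
  exact/derivable1_diffP/(@ex_derive _ _ _ _ _ _ _ (gdg x)).
have [c] := MVT_segment ler01 (fun x _ => gdg x) gcont.
rewrite in_itv/= => /andP[c0 c1].
have dgc : dg c <= 0.
  rewrite /dg subr_le0.
  have -> : w c - a = frob_dot D (grad f (Y + c *: D) - grad f Y).
    by rewrite frob_dotBr.
  rewrite (le_trans (ler_norm _))// normrM.
  rewrite (@le_trans _ _ `|frob_dot D (grad f (Y + c *: D) - grad f Y)|)//.
    by rewrite ler_piMl.
  have nD Z : `|frob_dot D Z| <= `|D| * `|Z|.
    rewrite ler_norml frob_dot_le andbT lerNl.
    by rewrite -mulN1r -frob_dotZl scaleN1r -(normrN D) frob_dot_le.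
  rewrite (le_trans (nD _))//.
  have := fsmooth (Y + c *: D) Y.
  rewrite [X in _ <= _ * `|X|](_ : _ = c *: D); last by rewrite addrAC subrr add0r.
  rewrite normrZ (ger0_norm c0) => H.
  rewrite (_ : 2 * c * b = `|D| * (beta * (c * `|D|))); last by rewrite /b; field.
  by rewrite ler_wpM2l.
rewrite subr0 mulr1 => gE; rewrite -gE in dgc; move: dgc.
rewrite /g scale1r scale0r addr0; lra.
Qed.

Lemma smooth_upper Y D :
  f (Y + D) <= f Y + frob_dot D (grad f Y) + beta / 2 * `|D| ^+ 2.
Proof.
have := @smooth_remainder 1 Y D; rewrite normr1 lexx => /(_ isT); lra.
Qed.

Lemma smooth_lower Y D :
  f Y + frob_dot D (grad f Y) - beta / 2 * `|D| ^+ 2 <= f (Y + D).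
Proof.
have := @smooth_remainder (- 1) Y D; rewrite normrN1 lexx => /(_ isT); lra.
Qed.

End Smooth.

(** Stands in for the limit s -> 0 in first-order arguments. *)
Lemma le_of_small_slack (R : realFieldType) (a b c : R) :
  (forall s, 0 < s <= 1 -> a <= b + s * c) -> a <= b.
Proof.
move=> abc; rewrite leNgt; apply/negP => ba.
(* With this [d], s = (a - b) / d is at most 1 and s c < a - b, a contradiction. *)
pose d := `|c| + (a - b) + 1.
have c0 := normr_ge0 c; have cc := ler_norm c.
have d0 : 0 < d by rewrite /d; lra.
have := abc ((a - b) / d); rewrite divr_gt0 ?subr_gt0// ler_pdivrMr// mul1r.
have -> : a - b <= d by rewrite /d; lra.
move=> /(_ isT); rewrite -lerBlDl mulrAC ler_pdivlMr//.
rewrite ler_pM2l ?subr_gt0// /d; lra.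
Qed.

(** * First-order conditions *)

Section Convex.
Context (R : realType) (n : nat) (f : Sym R n -> R) (beta : R).
Implicit Types X Y P : Sym R n.

Lemma convex_function_segment : convex_function [set: Sym R n] f ->
  forall X Y (a : R), 0 <= a <= 1 ->
  f (X + a *: (Y - X)) <= f X + a * (f Y - f X).
Proof.
move=> fconv X Y a /andP[a0 a1].
have := fconv (Itv01 a0 a1) Y X; rewrite !in_setT => /(_ isT isT).
rewrite /conv/= /conv/= => H.
rewrite [X in f X](_ : _ = a *: Y + (1 - a) *: X); last first.
  by rewrite scalerBr scalerBl scale1r addrCA addrA.
rewrite (le_trans H)// [leLHS](_ : _ = a * f Y + (1 - a) * f X)//; lra.
Qed.

Context (df : forall Y, differentiable f Y).
Context (fsmooth : smooth beta f).

(** Compare convexity and [smooth_lower] at Y + s (X - Y): after division by s the quadratic error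
    is of order s and vanishes. *)
Lemma convex_grad_le X Y : convex_function [set: Sym R n] f ->
  f Y + frob_dot (X - Y) (grad f Y) <= f X.
Proof.
move=> fconv; rewrite -lerBrDl.
apply: (@le_of_small_slack _ _ _ (beta / 2 * `|X - Y| ^+ 2)) => s /andP[s0 s1].
have s01 : 0 <= s <= 1 by rewrite ltW.
have := convex_function_segment fconv Y X s01.
have := smooth_lower df fsmooth Y (s *: (X - Y)).
rewrite frob_dotZl normrZ (gtr0_norm s0) => H1 H2.
rewrite -(ler_pM2l s0); nra.
Qed.

(** Same limit with [smooth_upper], along a segment that stays in the Fantope. *)
Lemma argmin_fantope_grad_ge0 k X Y : argmin (fantope k) f Y ->
  fantope k X -> 0 <= frob_dot (X - Y) (grad f Y).
Proof.
move=> [kY Ymin] kX.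
apply: (@le_of_small_slack _ _ _ (beta / 2 * `|X - Y| ^+ 2)) => s /andP[s0 s1].
have s01 : 0 <= s <= 1 by rewrite ltW.
have := Ymin _ (conv_hull_segment s01 kY kX).
have -> : (1 - s) *: Y + s *: X = Y + s *: (X - Y).
  by rewrite scalerBl scalerBr scale1r addrAC addrA.
have := smooth_upper df fsmooth Y (s *: (X - Y)).
rewrite frob_dotZl normrZ (gtr0_norm s0) => H1 H2.
rewrite -(ler_pM2l s0); nra.
Qed.

End Convex.

(** * Frank-Wolfe *)

Section FrankWolfe.
Context (R : realType) (n k : nat) (f : Sym R n -> R) (beta delta : R).
Context (Xs : Sym R n).
Implicit Types X Y V : Sym R n.
Context (k1n : (1 <= k < n)%N).
Context (fconv : convex_function [set: Sym R n] f).
Context (df : forall Y, differentiable f Y).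
Context (beta0 : 0 < beta).
Context (fsmooth : smooth beta f).
Context (Xsmin : argmin (fantope k) f Xs).
Context (delta0 : 0 < delta).
Context (gap :
  delta <= lambda (n - k) (grad f Xs) - lambda (n - k + 1) (grad f Xs)).

Lemma argmin_projectors_fantope G V X :
  argmin (projectors k) (fun W => frob_dot W G) V -> fantope k X ->
  frob_dot V G <= frob_dot X G.
Proof. by move=> [_ Vmin]; exact: conv_hull_dot_ge. Qed.

(** First-order optimality makes [Xs] a minimizer of the linear form given by its own gradient, so
    the eigen-gap applies. *)
Lemma grad_growth X : fantope k X ->
  delta / 2 * `|X - Xs| ^+ 2 <= frob_dot (X - Xs) (grad f Xs).
Proof.
move=> kX; have [kXs _] := Xsmin.
apply: (eigengap_growth k1n delta0 gap kXs _ kX) => W kW.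
have := argmin_fantope_grad_ge0 df fsmooth Xsmin (projectors_fantope kW).
by rewrite frob_dotBl subr_ge0.
Qed.

Lemma sqdist_le X : fantope k X ->
  `|X - Xs| ^+ 2 <= 2 / delta * (f X - f Xs).
Proof.
move=> /grad_growth growth.
have := convex_grad_le df fsmooth X Xs fconv.
rewrite mulrAC ler_pdivlMr//; lra.
Qed.

(** Apply the growth at [V], subtract <V - Xs, grad f X> <= 0, bound the gradient difference by
    smoothness and divide by |V - Xs|. *)
Lemma lmo_dist X V :
  argmin (projectors k) (fun W => frob_dot W (grad f X)) V ->
  fantope k X -> `|V - Xs| <= 2 * beta / delta * `|X - Xs|.
Proof.
move=> Vmin kX; have [kXs _] := Xsmin.
have [->|VXs] := eqVneq `|V - Xs| 0.
  by rewrite !mulr_ge0// ?invr_ge0 ltW.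
have VXs0 : 0 < `|V - Xs| by rewrite lt_neqAle eq_sym VXs normr_ge0.
have : delta / 2 * `|V - Xs| ^+ 2 <= `|V - Xs| * (beta * `|X - Xs|).
  rewrite (le_trans (grad_growth (projectors_fantope (proj1 Vmin))))//.
  rewrite -[leLHS](subrK (frob_dot (V - Xs) (grad f X))) -frob_dotBr.
  rewrite -[leRHS]addr0.
  rewrite lerD//; last by rewrite frob_dotBl subr_le0 argmin_projectors_fantope.
  rewrite (le_trans (frob_dot_le _ _))// ler_wpM2l// distrC.
  exact: fsmooth.
move: `|V - Xs| `|X - Xs| VXs0 => r s r0.
rewrite expr2 mulrCA ler_pM2l// => H; rewrite mulrAC ler_pdivlMr//; lra.
Qed.

Lemma lmo_sqdist X V :
  argmin (projectors k) (fun W => frob_dot W (grad f X)) V ->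
  fantope k X ->
  `|V - Xs| ^+ 2 <= 8 * (beta ^+ 2 / delta ^+ 3) * (f X - f Xs).
Proof.
move=> Vmin kX; have VX := lmo_dist Vmin kX.
apply: (@le_trans _ _ ((2 * beta / delta * `|X - Xs|) ^+ 2)).
  by rewrite ler_pXn2r// nnegrE// (le_trans _ VX).
rewrite exprMn.
have -> : 8 * (beta ^+ 2 / delta ^+ 3) * (f X - f Xs)
    = (2 * beta / delta) ^+ 2 * (2 / delta * (f X - f Xs)).
  by have dn := lt0r_neq0 delta0; field.
by rewrite ler_wpM2l ?sqr_ge0// sqdist_le.
Qed.

(** Either option does at least as well as any fixed step [e]: the quadratic model lies above [f] on
    the segment, and [eta] minimizes [f] or that model. *)
Lemma line_search_decrease X V eta e : line_search beta f X V eta ->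
  0 <= e <= 1 ->
  f ((1 - eta) *: X + eta *: V) <= f X - e * frob_dot (X - V) (grad f X)
    + e ^+ 2 * (beta / 2 * `|X - V| ^+ 2).
Proof.
have segE (a : R) : (1 - a) *: X + a *: V = X + a *: (V - X).
  by rewrite scalerBl scalerBr scale1r addrAC addrA.
have upper a : f ((1 - a) *: X + a *: V) <=
    f X + a * frob_dot (V - X) (grad f X) + a ^+ 2 * beta / 2 * `|V - X| ^+ 2.
  rewrite segE (le_trans (smooth_upper df fsmooth _ _))// frob_dotZl normrZ.
  rewrite exprMn real_normK ?num_real//; lra.
have e01 a : 0 <= a <= 1 -> `[0, 1]%classic a by rewrite /= in_itv.
have swap : f X - e * frob_dot (X - V) (grad f X)
      + e ^+ 2 * (beta / 2 * `|X - V| ^+ 2) =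
    f X + e * frob_dot (V - X) (grad f X) + e ^+ 2 * beta / 2 * `|V - X| ^+ 2.
  by rewrite (distrC X V) !frob_dotBl; field.
rewrite swap => -[] [_ etamin] /e01 /etamin.
  by move=> /le_trans; apply.
by move=> /(le_trans _); apply.
Qed.

(** The Frank-Wolfe gap dominates the error: convexity at [X], then [V] beats [Xs] in the linear
    form. *)
Lemma lmo_gap_ge X V :
  argmin (projectors k) (fun W => frob_dot W (grad f X)) V ->
  f X - f Xs <= frob_dot (X - V) (grad f X).
Proof.
move=> Vmin; have [kXs _] := Xsmin.
have := convex_grad_le df fsmooth Xs X fconv.
have := argmin_projectors_fantope Vmin kXs.
rewrite !frob_dotBl; lra.
Qed.

Lemma line_search_sublinear X V eta e :
  argmin (projectors k) (fun W => frob_dot W (grad f X)) V ->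
  fantope k X -> line_search beta f X V eta -> 0 <= e <= 1 ->
  f ((1 - eta) *: X + eta *: V) - f Xs <=
    (1 - e) * (f X - f Xs) + e ^+ 2 * (2 * beta * k%:R).
Proof.
move=> Vmin kX /line_search_decrease ls e01; have := ls e e01.
have gapXV := lmo_gap_ge Vmin.
have := fantope_sqdiam kX (projectors_fantope (proj1 Vmin)).
case/andP: e01 => e0 e1 diam.
have : e * (f X - f Xs) <= e * frob_dot (X - V) (grad f X) by rewrite ler_wpM2l.
have : e ^+ 2 * (beta / 2 * `|X - V| ^+ 2) <= e ^+ 2 * (beta / 2 * (4 * k%:R)).
  by rewrite ler_wpM2l ?sqr_ge0// ler_wpM2l// divr_ge0// ltW.
lra.
Qed.

Lemma line_search_linear X V eta :
  argmin (projectors k) (fun W => frob_dot W (grad f X)) V ->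
  fantope k X -> line_search beta f X V eta ->
  f X - f Xs <= delta ^+ 3 / (18 * beta ^+ 2) ->
  f ((1 - eta) *: X + eta *: V) - f Xs <=
    (f X - f Xs) * (1 - Num.min (delta / (12 * beta)) 2^-1).
Proof.
move=> Vmin kX ls hX.
have dn := lt0r_neq0 delta0; have bn := lt0r_neq0 beta0.
(* Quadratic growth gives (2 / delta) (delta^3 / (18 beta^2)) = (delta / (3 beta))^2. *)
have XXs : `|X - Xs| <= delta / (3 * beta).
  have r0 : 0 <= delta / (3 * beta) by rewrite ltW// divr_gt0// mulr_gt0.
  rewrite -(@ler_pXn2r _ 2)// ?nnegrE//.
  rewrite (le_trans (sqdist_le kX))//.
  rewrite [leRHS](_ : _ = 2 / delta * (delta ^+ 3 / (18 * beta ^+ 2)));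
    last by field; rewrite ?dn ?bn.
  by rewrite ler_wpM2l// divr_ge0// ltW.
have GG : `|grad f X - grad f Xs| <= delta / 3.
  rewrite (le_trans (fsmooth _ _))//.
  rewrite (_ : delta / 3 = beta * (delta / (3 * beta))); last by field.
  by rewrite ler_wpM2l// ltW.
have gapX :
    delta / 3 <= lambda (n - k) (grad f X) - lambda (n - k + 1) (grad f X).
  have i1 : (1 <= n - k <= n)%N by lia.
  have i2 : (1 <= n - k + 1 <= n)%N by lia.
  apply: le_trans (eigengap_perturb (grad f Xs) (grad f X) i1 i2).
  rewrite (_ : delta / 3 = delta - 2 * (delta / 3)); last by field.
  apply: lerB; first exact: gap.
  by rewrite (ler_pM2l (ltr0Sn _ 1)) distrC; exact: GG.
have kV := projectors_fantope (proj1 Vmin).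
have growth := eigengap_growth k1n (divr_gt0 delta0 (ltr0Sn _ 2)) gapX kV
  (proj2 Vmin) kX.
have hq := lmo_gap_ge Vmin; set q := frob_dot _ _ in growth hq.
(* With step 2 c, at most 1, the linear term gains 2 c q; since 12 beta c <= delta, the growth bound
   lets the quadratic term consume at most c q of it. *)
pose c := Num.min (delta / (12 * beta)) 2^-1.
have c0 : 0 <= c by rewrite le_min !divr_ge0 ?mulr_ge0// ?ltW ?invr_gt0.
have c2 : c <= 2^-1 by rewrite ge_min lexx orbT.
have cd : c <= delta / (12 * beta) by rewrite ge_min lexx.
have e01 : 0 <= 2 * c <= 1 by lra.
have := line_search_decrease ls e01; rewrite -/q => step.
have : c * (f X - f Xs) <= c * q by rewrite ler_wpM2l.
suff : (2 * c) ^+ 2 * (beta / 2 * `|X - V| ^+ 2) <= c * q by rewrite -/c; lra.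
have q0 : 0 <= q by apply: le_trans growth; rewrite mulr_ge0// !divr_ge0// ltW.
have cb : c * (12 * beta) <= delta by rewrite -ler_pdivlMr// mulr_gt0.
rewrite (_ : _ * _ = c * (c * (12 * beta) / 6 * `|X - V| ^+ 2)); last by field.
rewrite ler_wpM2l// (le_trans _ growth)// ler_wpM2r ?sqr_ge0//; lra.
Qed.

(** * The sequence of iterates *)

Context (X V : nat -> Sym R n) (eta : nat -> R).
Context (fw : frank_wolfe k beta f X V eta).

Lemma line_search_itv Y W a : line_search beta f Y W a -> 0 <= a <= 1.
Proof. by case=> -[]; rewrite /= in_itv. Qed.

Lemma frank_wolfe_fantope t : (1 <= t)%N -> fantope k (X t).
Proof.
have [kX1 step] := fw; case: t => // t _; elim: t => // t IH.
have [Vmin ls ->] := step t.+1 isT.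
apply: conv_hull_segment => //; first exact: line_search_itv ls.
exact: projectors_fantope (proj1 Vmin).
Qed.

Lemma frank_wolfe_sublinear t : (2 <= t)%N ->
  f (X t) - f Xs <= 8 * beta * k%:R / t%:R.
Proof.
have [_ step] := fw.
have bk : 0 <= beta * k%:R by rewrite mulr_ge0// ltW.
have next s e : (1 <= s)%N -> 0 <= e <= 1 -> f (X s.+1) - f Xs <=
    (1 - e) * (f (X s) - f Xs) + e ^+ 2 * (2 * beta * k%:R).
  move=> s1 e01; have [Vmin ls ->] := step s s1.
  exact: line_search_sublinear (frank_wolfe_fantope s1) ls e01.
case: t => [|[|t]]// _; elim: t => [|t IH].
  (* The full step e = 1 erases the error of the arbitrary starting point, hence the bound from
     index 2 on. *)
  have := next 1%N 1 isT; rewrite ler01 lexx => /(_ isT); lra.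
set T : R := t.+2%:R in IH *.
have T2 : 2 <= T by rewrite ler_nat.
have T0 : T != 0 by rewrite gt_eqF//; lra.
have T1 : 1 + T != 0 by rewrite gt_eqF//; lra.
have TS : t.+3%:R = 1 + T by rewrite -natr1 addrC.
(* The classical step 2 / (t + 1), which closes the induction. *)
pose e := 2 / (1 + T).
have e01 : 0 <= e <= 1.
  by rewrite divr_ge0 ?ler_pdivrMr ?mul1r//; lra.
have := next t.+2 e isT e01; rewrite TS => /le_trans; apply.
apply: (@le_trans _ _ ((1 - e) * (8 * beta * k%:R / T)
    + e ^+ 2 * (2 * beta * k%:R))).
  by rewrite lerD2r ler_wpM2l// subr_ge0; case/andP: e01.
rewrite -subr_ge0.
rewrite (_ : _ - _ = 8 * (beta * k%:R) / (T * (1 + T) ^+ 2)); last first.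
  by rewrite /e; clearbody T; field; rewrite T1 T0.
apply: divr_ge0; first by rewrite mulr_ge0.
apply: mulr_ge0; [lra|exact: sqr_ge0].
Qed.

End FrankWolfe.

Theorem theorem5 (R : realType) :
  exists2 C : R, 0 < C &
  forall (n k : nat) (f : Sym R n -> R) (beta delta : R) (Xstar : Sym R n)
    (X V : nat -> Sym R n) (eta : nat -> R),
  (1 <= k)%N -> (k < n)%N ->
  convex_function [set: Sym R n] f ->
  (forall Y, differentiable f Y) ->
  0 < beta -> smooth beta f ->
  argmin (fantope k) f Xstar ->
  0 < delta ->
  delta <= lambda (n - k) (grad f Xstar) - lambda (n - k + 1) (grad f Xstar) ->
  frank_wolfe k beta f X V eta ->
  (exists T0 : nat,
    [/\ (1 <= T0)%N,
        T0%:R <= C * Num.max 1 (k%:R * (beta / delta) ^+ 3)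
      & forall t, (T0 <= t)%N ->
        f (X t.+1) - f Xstar <=
        (f (X t) - f Xstar) * (1 - Num.min (delta / (12 * beta)) 2^-1)]) /\
  (forall t, (1 <= t)%N ->
    `|V t - Xstar| ^+ 2 <=
    C * (beta ^+ 2 / delta ^+ 3) * (f (X t) - f Xstar)).
Proof.
(* Here 144 = 8 * 18 makes 8 beta k / t fall below delta^3 / (18 beta^2); 2 more absorb the rounding
   and the start at index 2. The distance bound only needs 8. *)
exists 146 => // n k f beta delta Xs X V eta k1 kn fconv df beta0 fsmooth Xsmin.
move=> delta0 gap fw.
have k1n : (1 <= k < n)%N by rewrite k1.
have fant t (t1 : (1 <= t)%N) := frank_wolfe_fantope fw t1.
have [_ step] := fw; split; last first.
  move=> t t1; have [Vmin _ _] := step t t1.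
  have bd : 0 <= beta ^+ 2 / delta ^+ 3 by rewrite divr_ge0// exprn_ge0// ltW.
  have hX : 0 <= f (X t) - f Xs by rewrite subr_ge0 (proj2 Xsmin _ (fant t t1)).
  apply: le_trans (lmo_sqdist k1n fconv df beta0 fsmooth Xsmin delta0 gap Vmin
    (fant t t1)) _.
  by rewrite ler_wpM2r// ler_wpM2r// ler_nat.
set r := k%:R * _; have r0 : 0 <= r.
  by rewrite mulr_ge0// exprn_ge0// divr_ge0// ltW.
have /truncn_itv/andP[Nle ltN] : 0 <= 144 * r by rewrite mulr_ge0.
set N := Num.truncn (144 * r) in Nle ltN.
exists N.+2; split => //.
  rewrite -addn2 natrD.
  have m1 : 1 <= Num.max 1 r by rewrite le_max lexx.
  have mr : r <= Num.max 1 r by rewrite le_max lexx orbT.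
  lra.
move=> t Nt; have t1 : (1 <= t)%N by lia.
have [Vmin ls ->] := step t t1.
apply: (line_search_linear k1n fconv df beta0 fsmooth Xsmin delta0 gap Vmin
  (fant t t1) ls).
have t2 : (2 <= t)%N by lia.
apply: le_trans (frank_wolfe_sublinear fconv df beta0 fsmooth Xsmin fw t2) _.
have t0 : 0 < t%:R :> R by rewrite ltr0n.
have rt : 144 * r <= t%:R.
  by rewrite (le_trans (ltW ltN))// ler_nat ltnW.
have dn := lt0r_neq0 delta0; have bn := lt0r_neq0 beta0.
rewrite ler_pdivrMr//.
rewrite [leLHS](_ : _ = delta ^+ 3 / (18 * beta ^+ 2) * (144 * r)); last first.
  by rewrite /r; field; rewrite ?dn ?bn.
by rewrite ler_wpM2l// divr_ge0 ?mulr_ge0 ?exprn_ge0// ltW.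
Qed.
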